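(* Let $N$ be a non-negative integer and let $\alpha,\beta$ be real parameters. The generalized eigenvalue problem $$M P_n(x)=\lambda_n L P_n(x)$$ is solved by the polynomials $$P_n(x;\alpha,\beta,N)={}_3F_2\left({-n,\,-x,\,\alpha+1 \atop -N,\,1-\beta-n};1\right)$$ with eigenvalues $\lambda_n=n$, for $n=0,1,\dots,N$.
   Context: The operators $L,M$ act on the space of polynomials on the linear grid $x=0,1,\dots,N$ by $$L f(x)=(N-x)f(x+1)+(x-N-\alpha-1)f(x),$$ $$M f(x)=A(x)f(x+1)+B(x)f(x-1)+C(x)f(x),$$ with $A(x)=(N-x)(x-\beta+1)$, $B(x)=x(\alpha+\beta+N+1-x)$, $C(x)=-(A(x)+B(x))$. Here ${}_3F_2$ is the standard hypergeometric function; with $(a)_0=1$, $(a)_k=a(a+1)\cdots(a+k-1)$ the Pochhammer symbol, the terminating series is the finite sum $$P_n(x;\alpha,\beta,N)=\sum_{k=0}^{n}\frac{(-n)_k(-x)_k(\alpha+1)_k}{k!\,(-N)_k(1-\beta-n)_k}.$$ *)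

(* Defs.v *)
From HB Require Import structures.
From mathcomp Require Import all_boot all_order all_algebra.
From mathcomp Require Import reals.

Set Implicit Arguments.
Unset Strict Implicit.
Unset Printing Implicit Defensive.

Import Order.TTheory GRing.Theory Num.Theory.
Local Open Scope ring_scope.

(* (a)_k; it is used both for scalars and, in the factor (-x)_k, for
   polynomials in the variable x. *)
Definition pochhammer (A : nzRingType) (a : A) (k : nat) : A :=
  \prod_(j < k) (a + j%:R).

Definition opL (R : realType) (N : nat) (alpha : R) (f : {poly R}) : {poly R} :=
  (N%:R%:P - 'X) * (f \Po ('X + 1)) + ('X - (N%:R + alpha + 1)%:P) * f.

Definition opM_A (R : realType) (N : nat) (beta : R) : {poly R} :=
  (N%:R%:P - 'X) * ('X - beta%:P + 1).

Definition opM_B (R : realType) (N : nat) (alpha beta : R) : {poly R} :=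
  'X * ((alpha + beta + N%:R + 1)%:P - 'X).

Definition opM_C (R : realType) (N : nat) (alpha beta : R) : {poly R} :=
  - (opM_A N beta + opM_B N alpha beta).

Definition opM (R : realType) (N : nat) (alpha beta : R) (f : {poly R}) :
    {poly R} :=
  opM_A N beta * (f \Po ('X + 1)) + opM_B N alpha beta * (f \Po ('X - 1))
  + opM_C N alpha beta * f.

(* The terminating series 3F2(-n, -x, alpha + 1; -N, 1 - beta - n; 1) as a
   polynomial in x.  Division by zero is 0 in R, so this is the intended series
   only when no (-N)_k (1 - beta - n)_k with k <= n vanishes. *)
Definition hyp3P (R : realType) (n : nat) (alpha beta : R) (N : nat) :
    {poly R} :=
  \sum_(k < n.+1)
    (pochhammer (- n%:R) k * pochhammer (alpha + 1) k
      / (k`!%:R * pochhammer (- N%:R) k * pochhammer (1 - beta - n%:R) k))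
    *: pochhammer (- 'X) k.

(* The space of polynomials on the grid {0, ..., N} is the space of polynomials
   of degree at most N, which are determined by their values on the grid. *)
Definition gevp_solution (R : realType) (N : nat)
    (M L : {poly R} -> {poly R}) (lambda : R) (f : {poly R}) : Prop :=
  [/\ (size f <= N.+1)%N, f != 0 & M f = lambda *: L f].

Lemma horner_opL (R : realType) (N : nat) (alpha : R) (f : {poly R}) (x : R) :
  (opL N alpha f).[x] =
  (N%:R - x) * f.[x + 1] + (x - N%:R - alpha - 1) * f.[x].
Proof. by rewrite /opL !(hornerE, horner_comp) !opprD !addrA. Qed.

Lemma horner_opM (R : realType) (N : nat) (alpha beta : R) (f : {poly R})
    (x : R) :
  let A := (N%:R - x) * (x - beta + 1) in
  let B := x * (alpha + beta + N%:R + 1 - x) in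
  let C := - (A + B) in
  (opM N alpha beta f).[x] = A * f.[x + 1] + B * f.[x - 1] + C * f.[x].
Proof. by rewrite /opM /opM_C /opM_A /opM_B !(hornerE, horner_comp). Qed.

Lemma horner_hyp3P (R : realType) (n : nat) (alpha beta : R) (N : nat)
    (x : R) :
  (hyp3P n alpha beta N).[x] =
  \sum_(k < n.+1)
    (pochhammer (- n%:R) k * pochhammer (- x) k * pochhammer (alpha + 1) k)
    / (k`!%:R * pochhammer (- N%:R) k * pochhammer (1 - beta - n%:R) k).
Proof.
rewrite /hyp3P horner_sum; apply: eq_bigr => k _; rewrite hornerZ.
have -> : (pochhammer (- 'X) k).[x] = pochhammer (- x) k.
  rewrite /pochhammer horner_prod; apply: eq_bigr => j _.
  by rewrite hornerD hornerN hornerX -polyC_natr hornerC.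
by rewrite mulrAC [in RHS](mulrAC (pochhammer (- n%:R) k)).
Qed.

(* Main.v *)
(** In the basis [(-x)_k] the operator [M - n L] is lower bidiagonal:
    [(M - n L) (-x)_k = (n-k)(alpha+k+1) (-x)_k - k(N-k+1)(k-beta-n) (-x)_(k-1)],
    so [M P = n L P] is a two-term recurrence on the coefficients of [P], which
    the hypergeometric coefficients satisfy. *)
Require Import Defs.
From mathcomp Require Import all_boot all_order all_algebra.
From mathcomp Require Import reals.
From mathcomp Require Import ring.

Import Order.TTheory GRing.Theory Num.Theory.
Local Open Scope ring_scope.

Lemma pochhammer0 (A : nzRingType) (a : A) : pochhammer a 0 = 1.
Proof. by rewrite /pochhammer big_ord0. Qed.

Lemma pochhammerSr (A : nzRingType) (a : A) (k : nat) :
  pochhammer a k.+1 = pochhammer a k * (a + k%:R).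
Proof. by rewrite /pochhammer big_ord_recr. Qed.

Lemma pochhammerSl (A : nzRingType) (a : A) (k : nat) :
  pochhammer a k.+1 = a * pochhammer (a + 1) k.
Proof.
rewrite /pochhammer big_ord_recl addr0; congr (_ * _).
by apply: eq_bigr => j _; rewrite -addrA -[1]/(1%:R) -natrD.
Qed.

(** The factors are [j - N] with [j < k <= N], so the product stops before reaching the zero factor
    at [j = N]. *)
Lemma pochhammer_oppn_neq0 (R : numDomainType) (N k : nat) :
  (k <= N)%N -> pochhammer (- N%:R : R) k != 0.
Proof.
move=> le_kN; apply/prodf_neq0 => j _.
by rewrite addrC subr_eq0 eqr_nat ltn_eqF // (leq_trans (ltn_ord j)).
Qed.

Lemma pochhammer_comp_poly (R : comNzRingType) (p q : {poly R}) (k : nat) :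
  pochhammer p k \Po q = pochhammer (p \Po q) k.
Proof.
rewrite /pochhammer rmorph_prod; apply: eq_bigr => j _.
by rewrite rmorphD rmorph_nat.
Qed.

Lemma size_pochhammer_oppX (R : idomainType) (k : nat) :
  size (pochhammer (- 'X : {poly R}) k) = k.+1.
Proof.
have szE (j : nat) : size (- 'X + j%:R : {poly R}) = 2%N.
  by rewrite -size_polyN opprD opprK -polyC_natr size_XsubC.
elim: k => [|k IH]; first by rewrite pochhammer0 size_poly1.
rewrite pochhammerSr size_mul -?size_poly_gt0 ?IH ?szE //.
by rewrite addn2.
Qed.

(** For positive [k] the first factor is [- 'X]. At the origin a combination of these polynomials
    thus reduces to its constant coefficient, which serves to show that the solution is nonzero. *)
Lemma horner0_pochhammer_oppX (R : comNzRingType) (k : nat) :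
  (pochhammer (- 'X : {poly R}) k).[0] = (k == 0)%:R.
Proof.
case: k => [|k]; first by rewrite pochhammer0 hornerC.
by rewrite pochhammerSl hornerM hornerN hornerX oppr0 mul0r.
Qed.

Section Pencil.

Variables (R : realType) (N : nat) (alpha beta : R).

Lemma opL_sum (I : Type) (r : seq I) (c : I -> R) (f : I -> {poly R}) :
  opL N alpha (\sum_(i <- r) c i *: f i) =
  \sum_(i <- r) c i *: opL N alpha (f i).
Proof.
rewrite /opL linear_sum !mulr_sumr -big_split; apply: eq_bigr => i _.
by rewrite /= linearZ /= scalerDr !scalerAr.
Qed.

Lemma opM_sum (I : Type) (r : seq I) (c : I -> R) (f : I -> {poly R}) :
  opM N alpha beta (\sum_(i <- r) c i *: f i) =
  \sum_(i <- r) c i *: opM N alpha beta (f i).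
Proof.
rewrite /opM !linear_sum !mulr_sumr -!big_split; apply: eq_bigr => i _.
by rewrite /= !linearZ /= !scalerDr !scalerAr.
Qed.

Lemma pencil_pochhammer (n k : nat) :
  let phi := pochhammer (- 'X : {poly R}) in
  opM N alpha beta (phi k) - n%:R *: opL N alpha (phi k) =
  ((n%:R - k%:R) * (alpha + k%:R + 1)) *: phi k
  - (k%:R * (N%:R - k%:R + 1) * (k%:R - beta - n%:R)) *: phi k.-1.
Proof.
move=> phi; rewrite /opM /opM_C /opM_A /opM_B /opL /phi -!mul_polyC.
(* The truncated predecessor makes [k = 0] special: [phi k.-1] is then [phi 0], but its coefficient
   carries the factor [k] and vanishes. *)
case: k => [|k].
  rewrite !pochhammer0 !comp_polyC.
  rewrite !(polyCB, polyCD, polyCM, polyCN, polyC1, polyC_natr, polyC0); ring.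
have shift_up : pochhammer (- 'X : {poly R}) k.+1 \Po ('X + 1)
    = (- 'X - 1) * pochhammer (- 'X) k.
  rewrite pochhammer_comp_poly pochhammerSl.
  by rewrite raddfN /= comp_polyX opprD subrK.
(* The backward shift of [(-x)_(k+1)] is [(1-x)_(k+1)]. The factor [x] of [opM_B] supplies, up to
   sign, the missing first factor of [(-x)_(k+2)], whose last factor is then split off. *)
have shift_down : 'X * (pochhammer (- 'X : {poly R}) k.+1 \Po ('X - 1))
    = - ((- 'X + k.+1%:R) * pochhammer (- 'X) k.+1).
  rewrite pochhammer_comp_poly mulrC [_ * pochhammer _ _]mulrC -pochhammerSr.
  rewrite [pochhammer _ k.+2]pochhammerSl.
  by rewrite raddfN /= comp_polyX opprB mulNr opprK mulrC [1 - _]addrC.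
(* Every term is now a multiple of [(-x)_k], with [k] the predecessor index, so a polynomial
   identity in [x] remains. *)
rewrite shift_up [_ * (_ - 'X) * (_ \Po _)]mulrAC shift_down /= pochhammerSr.
rewrite -!natr1 !(polyCB, polyCD, polyCM, polyCN, polyC1, polyC_natr).
by ring.
Qed.

End Pencil.

(** Each [u k] cancels against [s k.+1], and the two unmatched end terms [s 0] and [u n] vanish. For
    a bidiagonal operator, [u] collects the diagonal terms and [s] the lowered ones. *)
Lemma telescope_sumr_eq (V : zmodType) (n : nat) (u s : nat -> V) :
  s 0%N = 0 -> (forall k, (k < n)%N -> s k.+1 = u k) -> u n = 0 ->
  \sum_(k < n.+1) (u k - s k) = 0.
Proof.
move=> s0 su un; rewrite sumrB big_ord_recr big_ord_recl /= un s0 addr0 add0r.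
by rewrite -sumrB big1 // => k _; rewrite su ?subrr.
Qed.

Theorem proposition3p1 (R : realType) (N : nat) (alpha beta : R) (n : nat)
    (hn : (n <= N)%N)
    (hdef : forall k : nat, (k <= n)%N -> pochhammer (1 - beta - n%:R) k != 0) :
  gevp_solution N (opM N alpha beta) (opL N alpha) n%:R (hyp3P n alpha beta N).
Proof.
rewrite /hyp3P; split.
- apply: leq_trans (size_sum _ _ _) _; apply/bigmax_leqP => k _.
  apply: leq_trans (size_scale_leq _ _) _.
  by rewrite size_pochhammer_oppX ltnS (leq_trans _ hn) // -ltnS.
- suff P0 : (hyp3P n alpha beta N).[0] = 1.
    apply/eqP => P_eq0; move/eqP: P0.
    by rewrite /hyp3P P_eq0 horner0 eq_sym oner_eq0.
  rewrite /hyp3P horner_sum big_ord_recl big1 => [|k _].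
    by rewrite hornerZ !pochhammer0 hornerC fact0 !mulr1 divr1 addr0.
  by rewrite hornerZ horner0_pochhammer_oppX mulr0.
- pose c (k : nat) : R := pochhammer (- n%:R) k * pochhammer (alpha + 1) k
      / (k`!%:R * pochhammer (- N%:R) k * pochhammer (1 - beta - n%:R) k).
  apply/eqP; rewrite -subr_eq0 opM_sum opL_sum scaler_sumr -sumrB; apply/eqP.
  under eq_bigr => k _.
    rewrite -/(c k) (scalerA n%:R) (mulrC n%:R) -(scalerA (c k)) -scalerBr.
    rewrite pencil_pochhammer scalerBr !scalerA.
    over.
  pose d (k : nat) : R := k%:R * (N%:R - k%:R + 1) * (k%:R - beta - n%:R).
  apply: (@telescope_sumr_eq _ n
    (fun k => (c k * ((n%:R - k%:R) * (alpha + k%:R + 1)))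
              *: pochhammer (- 'X) k)
    (fun k => (c k * d k) *: pochhammer (- 'X) k.-1)).
  + by rewrite /d !mul0r mulr0 scale0r.
  (* The two-term recurrence [c (k+1) * d (k+1) = c k * (n-k) * (alpha+k+1)]: up to sign, [d (k+1)]
     is what the denominator of [c] gains from [k] to [k+1]. Since [k+1 <= n <= N], no denominator
     is zero. *)
  + move=> k lt_kn; rewrite /=; congr (_ *: _).
    have Nk := @pochhammer_oppn_neq0 R _ _ (leq_trans lt_kn hn).
    have bk := hdef _ lt_kn.
    have fk : (k.+1`!%:R : R) != 0 by rewrite pnatr_eq0 -lt0n fact_gt0.
    move: Nk bk fk; rewrite /c /d factS natrM !pochhammerSr !mulf_eq0 !negb_or.
    rewrite -!natr1 => /andP[N0 N1] /andP[b0 b1] /andP[k0 f0].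
    field.
    by rewrite f0 k0 N0 N1 b0 b1.
  (* The eigenvalue [n] makes the top diagonal coefficient zero, so the series may stop at
     [k = n]. *)
  + by rewrite subrr mul0r mulr0 scale0r.
Qed.
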